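(* Let $f\colon[0,1]\to[0,1]$ be a continuous map. Then $h_{\mathrm{pol}}(f)=0$ if and only if the set $\mathrm{Per}(f)$ of periodic points of $f$ is connected. Moreover, such a map is necessarily of Sharkovskii type $1$ or $2$.
   Context: Polynomial entropy: $S$ is $(n,\varepsilon,f)$-separated if $\max_{0\le i\le n-1}|f^i(x)-f^i(y)|>\varepsilon$ for any distinct $x,y\in S$; $\mathrm{sep}(n,\varepsilon,f)$ is the maximal cardinality of an $(n,\varepsilon,f)$-separated set; $h_{\mathrm{pol}}(f)=\lim_{\varepsilon\to0}\limsup_{n\to\infty}\frac{\log\mathrm{sep}(n,\varepsilon,f)}{\log n}$. Sharkovskii type: the Sharkovskii order on $\mathbb N\cup\{2^\infty\}$ is $1\prec2\prec4\prec8\prec\cdots\prec2^\infty\prec\cdots\prec 2^2\cdot5\prec2^2\cdot3\prec\cdots\prec2\cdot5\prec2\cdot3\prec\cdots\prec7\prec5\prec3$. The Sharkovskii type of $f$ is the $\prec$-maximum of the (least) periods of its periodic points, or $2^\infty$ if the set of periods is the set of all powers of $2$. Thus type $1$ means that all periodic points are fixed, and type $2$ means that the set of periods is $\{1,2\}$. *)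

(* Defs.v *)
From HB Require Import structures.
From mathcomp Require Import all_boot all_order all_algebra.
From mathcomp Require Import finmap.
From mathcomp Require Import all_classical all_reals all_analysis.
Import Order.TTheory GRing.Theory Num.Theory.
Import numFieldNormedType.Exports.

Set Implicit Arguments.
Unset Strict Implicit.
Unset Printing Implicit Defensive.

Local Open Scope classical_set_scope.
Local Open Scope ring_scope.

(* A self-map of [0, 1] is represented by a function R -> R mapping [0, 1] to
   itself; the definitions below only look at points of [0, 1], hence do not
   depend on the values of the function outside [0, 1]. *)

Section PolynomialEntropy.
Context {R : realType}.
Implicit Types (f : R -> R) (n : nat) (eps : R).

Definition dynamic_dist n f (x y : R) : R :=
  \big[Num.max/0]_(i < n) `|iter i f x - iter i f y|.

Definition separated n eps f (S : set R) : Prop :=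
  S `<=` `[0, 1] /\
  forall x y, S x -> S y -> x <> y -> eps < dynamic_dist n f x y.

(* When f is continuous on [0, 1], eps > 0 and n > 0, separated sets are finite
   and of bounded cardinality, so this supremum is a maximum. *)
Definition sep n eps f : \bar R :=
  ereal_sup [set ((#|` S|)%:R)%:E |
              S in [set S : {fset R} | separated n eps f [set` S]]].

(* The limsup is nonincreasing in eps, so the limit at 0+ exists in \bar R. The
   terms n = 0 and n = 1, where the denominator is not positive, do not affect
   the limsup. *)
Definition h_pol f : \bar R :=
  lim (limn_esup (fun n => lne (sep n eps f) * ((ln n%:R)^-1)%:E)%E
         @[eps --> 0^'+]).

End PolynomialEntropy.

Section Periods.
Context {R : realType}.
Implicit Types (f : R -> R) (n : nat) (x : R).

Definition Per f : set R :=
  [set x | `[0, 1]%classic x /\ exists2 n, (0 < n)%N & iter n f x = x].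

Definition least_period f x n : Prop :=
  [/\ (0 < n)%N, iter n f x = x
    & forall m, (0 < m < n)%N -> iter m f x <> x].

Definition periods f : set nat :=
  [set n | exists2 x, `[0, 1]%classic x & least_period f x n].

End Periods.

(* Only positive n are meaningful in Period n. *)
Inductive sharkovskii := Period of nat | TwoInfty.

Definition odd_part (n : nat) : nat := (n`_2^')%N.

(* For n > 0, n = 2 ^ (logn 2 n) * odd_part n. The powers of 2 come first, in
   increasing order, then TwoInfty, then the other integers by decreasing 2-adic
   valuation and, for a fixed valuation, by decreasing odd part. *)
Definition sharkovskii_lt (s t : sharkovskii) : bool :=
  match s, t with
  | Period n, Period m =>
      if odd_part n == 1%N then (1 < odd_part m)%N || (logn 2 n < logn 2 m)%N
      else (1 < odd_part m)%N &&
        ((logn 2 m < logn 2 n)%N ||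
         (logn 2 m == logn 2 n) && (odd_part m < odd_part n)%N)
  | Period n, TwoInfty => odd_part n == 1%N
  | TwoInfty, Period m => (1 < odd_part m)%N
  | TwoInfty, TwoInfty => false
  end.

Definition sharkovskii_type {R : realType} (f : R -> R) (t : sharkovskii) : Prop :=
  match t with
  | Period n =>
      periods f n /\
      forall m, periods f m -> m = n \/ sharkovskii_lt (Period m) (Period n)
  | TwoInfty => periods f = range (fun k : nat => (2 ^ k)%N)
  end.

(* Main.v *)
(* If some point c between two periodic points is not periodic, then a common
   iterate g fixes both of them but moves c, say p < c < g c with g p = p. By
   the intermediate value theorem c has a backward orbit u 0 = c, g (u n.+1) =
   u n, inside [p, c], bounded away from c from u 1 on; its first n points are
   separated within n steps of g, so h_pol f > 0.
   If Per f is an interval, f is injective on it, hence monotone, so that f^2 is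
   the identity on Per f = [a, b]. The intersection of the images of [0, 1]
   under the iterates of g = f^2 is then [a, b] itself, hence all orbits
   approach [a, b] uniformly and settle near one of its points; the iterates of
   f are equicontinuous and separated sets have bounded cardinality. *)

Require Import Defs.
From HB Require Import structures.
From mathcomp Require Import all_boot all_order all_algebra finmap ring lra zify.
From mathcomp Require Import all_classical all_reals all_analysis.
Import Order.TTheory GRing.Theory Num.Theory.
Import numFieldNormedType.Exports.
Local Open Scope classical_set_scope.
Local Open Scope ring_scope.
Set Implicit Arguments.
Unset Strict Implicit.
Unset Printing Implicit Defensive.

(** * Separated sets and polynomial entropy *)

Section Entropy.
Context {R : realType}.
Implicit Types (f : R -> R) (e : R) (n k : nat).

Lemma sep_ge1 n e f : (1 <= sep n e f)%E.
Proof.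
apply: ereal_sup_ubound; exists [fset 0]%fset; last by rewrite cardfs1.
split=> [x /= /fset1P ->|x y /= /fset1P -> /fset1P -> //].
by rewrite in_itv /= lexx ler01.
Qed.

Lemma sep_le n e f (M : nat) :
  (forall S : {fset R}, Defs.separated n e f [set` S] -> (#|` S| <= M)%N) ->
  (sep n e f <= (M%:R)%:E)%E.
Proof.
move=> H; apply: ge_ereal_sup => _ [S /H SM <-].
by rewrite lee_fin ler_nat.
Qed.

Lemma sep_antitone n e e' f : e <= e' -> (sep n e' f <= sep n e f)%E.
Proof.
move=> ee'; apply: ereal_sup_le => _ [S [SI Ssep] <-]; exists S => //.
split=> // x y Sx Sy xy; exact: le_lt_trans ee' (Ssep x y Sx Sy xy).
Qed.

Lemma lne_homo (x y : \bar R) : (0 <= x)%E -> (x <= y)%E -> (lne x <= lne y)%E.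
Proof.
move=> x0 xy; rewrite lee_lne// in_itv /= leey andbT//.
exact: le_trans xy.
Qed.

Lemma ln_nat_ge0 n : 0 <= (ln n%:R : R).
Proof. by case: n => [|n]; [rewrite ln0|rewrite ln_ge0// ler1n]. Qed.

Definition sep_rate e f n : \bar R := (lne (sep n e f) * ((ln n%:R)^-1)%:E)%E.

Lemma sep_rate_ge0 e f n : (0 <= sep_rate e f n)%E.
Proof.
by rewrite mule_ge0 ?lne_ge0 ?sep_ge1// lee_fin invr_ge0 ln_nat_ge0.
Qed.

Lemma lee_sep_rate e f n (r : R) : 0 < r -> (r%:E <= sep n e f)%E ->
  ((ln r / ln n%:R)%:E <= sep_rate e f n)%E.
Proof.
move=> r0 rsep; rewrite EFinM lee_wpmul2r ?lee_fin ?invr_ge0 ?ln_nat_ge0//.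
by rewrite -lne_EFin// lne_homo// lee_fin ltW.
Qed.

Lemma gee_sep_rate e f n (r : R) : (sep n e f <= r%:E)%E ->
  (sep_rate e f n <= (ln r / ln n%:R)%:E)%E.
Proof.
move=> rsep; have r1 : 1 <= r by rewrite -lee_fin (le_trans (sep_ge1 n e f)).
rewrite EFinM lee_wpmul2r ?lee_fin ?invr_ge0 ?ln_nat_ge0//.
rewrite -lne_EFin ?(lt_le_trans ltr01)// lne_homo//.
by rewrite (le_trans _ (sep_ge1 n e f))// lee_fin.
Qed.

Lemma sep_rate_antitone n e e' f :
  e <= e' -> (sep_rate e' f n <= sep_rate e f n)%E.
Proof.
move=> ee'; rewrite lee_wpmul2r ?lee_fin ?invr_ge0 ?ln_nat_ge0//.
by rewrite lne_homo ?sep_antitone// (le_trans _ (sep_ge1 _ _ _))// lee_fin.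
Qed.

Lemma ln_nat_cvgy : (ln n%:R : R) @[n --> \oo] --> +oo.
Proof.
apply/cvgryPge => A; near=> n.
rewrite -[A]expRK ler_ln ?posrE ?expR_gt0//; last first.
  by rewrite ltr0n; near: n; exact: nbhs_infty_gt.
by near: n; have /cvgryPge := @cvgr_idn R; exact.
Unshelve. all: by end_near. Qed.

(** A bound [M] uniform in [n] squeezes the rate between 0 and [ln M / ln n], which tends to 0. *)
Lemma h_pol_eq0 f :
  (forall e, 0 < e -> exists M : nat, forall n (S : {fset R}),
     Defs.separated n e f [set` S] -> (#|` S| <= M)%N) ->
  h_pol f = 0%E.
Proof.
move=> H; apply: lim_near_cst => //; near=> e.
have /H [M MP] : 0 < e by [].
suff /cvg_limn_einf_sup [_ ->] : sep_rate e f n @[n --> \oo] --> 0%E by [].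
have Mcvg : ((ln M%:R / ln n%:R : R)%:E) @[n --> \oo] --> 0%E.
  apply: cvg_EFin; first exact: nearW.
  rewrite -[X in _ --> X](mulr0 (ln M%:R : R)); apply: cvgMr.
  apply/(gtr0_cvgV0 (f := fun n => ln n%:R)); last exact: ln_nat_cvgy.
  by near=> n; apply: ln_gt0; rewrite ltr1n; near: n; exact: nbhs_infty_gt.
apply: squeeze_cvge (cvg_cst _) Mcvg; apply: nearW => n.
by rewrite sep_rate_ge0 gee_sep_rate// sep_le// => S; exact: MP.
Unshelve. all: by end_near. Qed.

(** The rates increase as [e] decreases, so a single scale bounds the limit at 0 from below; for the
    limsup, arbitrarily large [n] suffice. *)
Lemma h_pol_ge f e (l : R) : 0 < e ->
  (forall N, exists2 n, (N <= n)%N & (l%:E <= sep_rate e f n)%E) ->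
  (l%:E <= h_pol f)%E.
Proof.
move=> e0 H; apply: lime_ge.
  apply: nonincreasing_at_right_is_cvge; apply: nearW => x e1 e2 _ _ e12.
  rewrite !limn_esup_lim; apply: lee_lim; [exact: is_cvg_esups..|].
  apply: nearW => n; apply: ge_ereal_sup => _ [m nm <-].
  apply: (@le_trans _ _ (sep_rate e1 f m)); last first.
    by apply: ereal_sup_ubound; exists m.
  exact: sep_rate_antitone.
near=> d; have de : d <= e by near: d; exact: nbhs_right_le.
rewrite limn_esup_lim; apply: lime_ge; first exact: is_cvg_esups.
apply: nearW => N; have [n Nn /le_trans] := H N; apply.
apply: (@le_trans _ _ (sep_rate d f n)); last first.
  by apply: ereal_sup_ubound; exists n.
exact: sep_rate_antitone.
Unshelve. all: by end_near. Qed.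

(** Linear growth is enough: once [k <= n], one has [k * n <= n ^ 2], hence
    [ln n / ln (k * n) >= 1 / 2]. *)
Lemma h_pol_neq0 f e k : 0 < e -> (0 < k)%N ->
  (forall n, exists2 S : {fset R},
     Defs.separated (k * n) e f [set` S] & #|` S| = n) ->
  h_pol f <> 0%E.
Proof.
move=> e0 k0 H h0.
suff : ((2^-1 : R)%:E <= h_pol f)%E by rewrite h0 lee_fin; lra.
(* The summand [N] puts the time [k * n] beyond [N], [k] ensures [k * n <= n ^ 2], and 2 makes
   [ln (k * n)] positive. *)
apply: (h_pol_ge e0) => N; pose n := (N + k + 2)%N.
have [S Ssep Sn] := H n.
exists (k * n)%N; first by rewrite /n; nia.
have n_sep : ((n%:R)%:E <= sep (k * n) e f)%E.
  by apply: ereal_sup_ubound; exists S => //; rewrite Sn.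
have n0 : (0 : R) < n%:R by rewrite ltr0n /n; lia.
apply: le_trans (lee_sep_rate n0 n_sep); rewrite lee_fin.
have ln0 : (0 : R) < ln (k * n)%:R by apply: ln_gt0; rewrite ltr1n /n; nia.
rewrite ler_pdivlMr// mulrC ler_pdivrMr// mulr_natr -lnXn//.
rewrite ler_ln ?posrE ?exprn_gt0//.
  by rewrite -natrX ler_nat /n; nia.
by rewrite ltr0n /n; nia.
Qed.

End Entropy.

(** * Equicontinuous iterates *)

Section Equicontinuity.
Context {R : realType}.
Implicit Types (f g : R -> R) (e : R).

Lemma uniform_continuity f e : continuous f -> 0 < e ->
  exists2 d, 0 < d & forall x y, 0 <= x <= 1 -> `|x - y| <= d -> `|f x - f y| <= e.
Proof.
move=> cf e0.
(* The near-covering form of compactness, with the filter of small positive [d], merges the local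
   moduli of continuity at points of [0, 1] into one. *)
have /compact_near_coveringP cover := @segment_compact R 0 1.
have [] := @cover R 0^'+
  (fun d x => forall y, `|x - y| <= d -> `|f x - f y| <= e).
  move=> x _.
  have e20 : 0 < e / 2 by lra.
  have /cvgrPdist_lt/(_ _ e20) [r /= r0 rP] := cf x.
  exists (ball x (r / 2), [set d | d < r / 2]).
    by split; [exact: nbhsx_ballx (divr_gt0 _ _)|exact: nbhs_right_lt (divr_gt0 _ _)].
  case=> x' d /= [xx' dr] y xy.
  have {}xx' : `|x - x'| < r / 2 by [].
  have fx' : `|f x - f x'| < e / 2 by apply: rP => /=; lra.
  have fy : `|f x - f y| < e / 2.
    apply: rP => /=; have := ler_distD x' x y; lra.
  have := ler_distD (f x) (f x') (f y); rewrite (distrC (f x') (f x)); lra.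
move=> d /= d0 dP; exists (d / 2); first lra.
move=> x y xI xy; apply: (dP (d / 2)) xy; rewrite /= ?in_itv //=; last lra.
by rewrite sub0r normrN gtr0_norm; lra.
Qed.

Definition self_map f := forall x : R, 0 <= x <= 1 -> 0 <= f x <= 1.

Lemma iter_self f n : self_map f -> self_map (iter n f).
Proof. by move=> fI x xI; elim: n => //= n /fI. Qed.

Lemma iter_continuous f n : continuous f -> continuous (iter n f).
Proof.
move=> cf; elim: n => [|n IHn] x; first exact: cvg_id.
exact: continuous_comp (IHn x) (cf _).
Qed.

Lemma uniform_continuity_iter f e N : continuous f -> self_map f -> 0 < e ->
  exists2 d, 0 < d & forall x y, 0 <= x <= 1 -> 0 <= y <= 1 -> `|x - y| <= d ->
    forall n, (n <= N)%N -> `|iter n f x - iter n f y| <= e.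
Proof.
move=> cf fI e0; elim: N => [|N [d d0 dP]].
  by exists e => // x y _ _ xy n; rewrite leqn0 => /eqP ->.
have [d' d'0 d'P] := uniform_continuity (@iter_continuous f N.+1 cf) e0.
exists (Num.min d d'); first by rewrite lt_min d0.
move=> x y xI yI; rewrite le_min => /andP[xyd xyd'] n.
by rewrite leq_eqVlt ltnS => /predU1P[->|nN]; [exact: d'P|exact: dP].
Qed.

Definition equicontinuous_iterates f := forall e, 0 < e ->
  exists2 d, 0 < d & forall x y, 0 <= x <= 1 -> 0 <= y <= 1 -> `|x - y| <= d ->
    forall n, `|iter n f x - iter n f y| <= e.

(** Pigeonhole: two points in the same box of width [d] stay [e]-close forever, so a separated set
    has at most one point in each of the boxes [0, ..., box 1]. *)
Lemma equicontinuous_h_pol f : equicontinuous_iterates f -> h_pol f = 0%E.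
Proof.
move=> eqf; apply: h_pol_eq0 => e e0; have [d d0 dP] := eqf _ e0.
pose box (x : R) := Num.trunc (x / d).
exists (box 1).+1 => n S [SI Ssep].
have {}SI x : x \in S -> 0 <= x <= 1 by move=> /SI; rewrite /= in_itv.
rewrite -(size_map box) -[leqRHS](size_iota 0); apply: uniq_leq_size.
  rewrite map_inj_in_uniq ?fset_uniq// => x y Sx Sy xy.
  apply: contrapT => /(Ssep x y Sx Sy); apply/negP; rewrite -leNgt.
  have xI := SI x Sx; have yI := SI y Sy.
  apply: bigmax_le => [|i _]; first exact: ltW.
  apply: dP => //.
  have /truncn_itv : 0 <= x / d by rewrite divr_ge0//; lra.
  have /truncn_itv : 0 <= y / d by rewrite divr_ge0//; lra.
  rewrite -/(box x) -/(box y) xy -natr1; move: (box y)%:R => t yt xt.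
  have : `|x / d - y / d| <= 1 by rewrite ler_norml; lra.
  by rewrite -mulrBl normrM normfV (gtr0_norm d0) ler_pdivrMr ?mul1r.
move=> _ /mapP[x Sx ->]; have xI := SI x Sx.
by rewrite mem_iota ltnS le_truncn// ler_pM2r ?invr_gt0//; lra.
Qed.

Lemma iter_comp_iter f m n x : iter n (iter m f) x = iter (n * m) f x.
Proof. by elim: n => // n IHn; rewrite mulSn iterD /= IHn. Qed.

(** An iterate of [f] is an iterate of [f^2] followed by at most one application of [f]. *)
Lemma equicontinuous_iter2 f : continuous f -> self_map f ->
  equicontinuous_iterates (iter 2 f) -> equicontinuous_iterates f.
Proof.
move=> cf fI eqf e e0; have [d d0 dP] := uniform_continuity_iter 1 cf fI e0.
have [d' d'0 d'P] := eqf _ d0; exists d' => // x y xI yI xy n.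
have gI : self_map (iter n./2 (iter 2 f)) by do 2 apply: iter_self.
have -> : n = (odd n + n./2 * 2)%N by rewrite -[LHS]odd_double_half muln2.
rewrite !iterD -!iter_comp_iter; apply: dP; last by case: (odd n).
- exact: gI.
- exact: gI.
- exact: d'P.
Qed.

Lemma ivt f a b v : continuous f -> a <= b ->
  f a <= v <= f b \/ f b <= v <= f a -> exists2 c, a <= c <= b & f c = v.
Proof.
move=> cf ab fv.
have [||c] := @IVT R f a b v ab; first exact: continuous_subspaceT.
  by rewrite ge_min le_max; case: fv => /andP[-> ->]; rewrite ?orbT.
by rewrite in_itv => ? ?; exists c.
Qed.

End Equicontinuity.

(** * Backward orbits *)

Section BackwardOrbit.
Context {R : realType}.
Implicit Types (f g : R -> R) (e : R).

Lemma iter_backward g (u : nat -> R) i j :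
  (forall n, g (u n.+1) = u n) -> iter i g (u (i + j)%N) = u j.
Proof. by move=> gu; elim: i => // i IHi; rewrite addSn iterSr gu. Qed.

(** For [i < j], after [i] steps of [f^k] the point [u i] has reached [u 0] while [u j] is at
    [u (j - i)], at distance at least [d]. Halving [d] gives the strict inequality required of
    separated sets. *)
Lemma backward_orbit_h_pol f (u : nat -> R) k d : (0 < k)%N -> 0 < d ->
  (forall n, 0 <= u n <= 1) -> (forall n, iter k f (u n.+1) = u n) ->
  (forall n, d <= `|u 0%N - u n.+1|) -> h_pol f <> 0%E.
Proof.
move=> k0 d0 uI fu ud; have d20 : 0 < d / 2 by lra.
have far n i j : (i < j < n)%N -> d / 2 < dynamic_dist (k * n) f (u i) (u j).
  move=> /andP[ij jn]; apply: (@lt_le_trans _ _ d); first lra.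
  have ikn : (i * k < k * n)%N by nia.
  apply: le_trans (le_bigmax _ _ (Ordinal ikn)); rewrite /= -!iter_comp_iter.
  have := iter_backward i 0 fu; rewrite addn0 => ->.
  have -> : j = (i + (j - i).-1.+1)%N by lia.
  by rewrite (iter_backward _ _ fu).
have {}far n i j : (i < n)%N -> (j < n)%N -> i <> j ->
    d / 2 < dynamic_dist (k * n) f (u i) (u j).
  move=> ni nj; have [ij _|ji _|//] := ltngtP i j; first by rewrite far ?ij.
  suff -> : dynamic_dist (k * n) f (u i) (u j) = dynamic_dist (k * n) f (u j) (u i).
    by rewrite far ?ji.
  by apply: eq_bigr => m _; rewrite distrC.
apply: (h_pol_neq0 d20 k0) => n.
have u_inj : {in iota 0 n &, injective u}.
  move=> i j; rewrite !mem_iota !add0n => /= ni nj uij.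
  apply: contrapT => /(far _ _ _ ni nj); apply/negP; rewrite -leNgt uij.
  by apply: bigmax_le => [|m _]; rewrite ?subrr ?normr0 ltW.
set S := [fset x in map u (iota 0 n)]%fset.
have memS x : x \in S -> exists2 i, (i < n)%N & x = u i.
  by rewrite !inE => /mapP[i + ->]; rewrite mem_iota add0n => ?; exists i.
exists S; last first.
  by rewrite card_fseq undup_id ?map_inj_in_uniq ?iota_uniq// size_map size_iota.
split=> [x /= /memS [i _ ->]|x y /= /memS [i ni ->] /memS [j nj ->] uij].
  by rewrite in_itv /= uI.
by apply: far => // ij; rewrite ij in uij.
Qed.

(** The conjugate of [g] by the reflection of [0, 1], which turns statements about left ends into
    statements about right ends. *)
Definition flip g (x : R) := 1 - g (1 - x).

Lemma flipK g : flip (flip g) = g.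
Proof. by apply/funext => x; rewrite /flip !subKr. Qed.

Lemma iter_flip g n x : iter n (flip g) x = 1 - iter n g (1 - x).
Proof. by elim: n => [|n /= ->]; rewrite ?subKr// /flip subKr. Qed.

Lemma flip_self g : self_map g -> self_map (flip g).
Proof.
move=> gI x xI; have := gI (1 - x); rewrite /flip.
have -> : 0 <= 1 - x <= 1 by lra.
by move=> /(_ isT); lra.
Qed.

Lemma flip_continuous g : continuous g -> continuous (flip g).
Proof.
move=> cg x; apply: cvgB; first exact: cvg_cst.
have c1 : continuous (fun y : R => 1 - y).
  by move=> y; apply: cvgB; [exact: cvg_cst|exact: cvg_id].
exact: continuous_comp (c1 x) (cg _).
Qed.

(** If [p <= y <= g y], the intermediate value theorem on [[p, y]] gives [z] with [g z = y]; then
    [z <= y = g z], so the step can be repeated. The orbit decreases, and [u 1] differs from [c]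
    because [c] is not fixed. *)
Lemma backward_orbit g p c : continuous g -> g p = p -> p < c -> c < g c ->
  exists u : nat -> R, [/\ u 0%N = c, forall n, p <= u n <= c,
    forall n, g (u n.+1) = u n & forall n, u n.+1 <= u 1%N /\ u 1%N < c].
Proof.
move=> cg gp pc cgc.
(* The hypothesis on [y] is placed under the existential so that [choice] gives a total function; 0
   is a dummy value. *)
have step y : exists z, p <= y <= g y -> p <= z <= y /\ g z = y.
  have [ygy|] := boolP (p <= y <= g y); last by exists 0.
  have [||z zy gz] := ivt (f := g) (a := p) (b := y) (v := y) cg; [lra|left; lra|].
  by exists z => _; split.
have [h hP] := choice step; pose u n := iter n h c.
have uP n : p <= u n <= g (u n) /\ u n <= c.
  elim: n => [|n [IHn unc]]; first by rewrite /u /=; lra.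
  by have [] := hP _ IHn; rewrite -iterS -/(u n.+1) => ? ->; lra.
have u_step n : p <= u n.+1 <= u n /\ g (u n.+1) = u n.
  by have [+ _] := uP n; exact: hP.
exists u; split=> // [n|n|n]; first by have := uP n; lra.
  by have [] := u_step n.
split.
  by elim: n => // n IHn; have [+ _] := u_step n.+1; lra.
have [+ gu1] := u_step 0%N; rewrite -[u 0%N]/c => u1.
rewrite lt_neqAle; apply/andP; split; last lra.
by apply/eqP => u1c; move: gu1; rewrite u1c -[u 0%N]/c; lra.
Qed.

Lemma Per_is_interval f : continuous f -> self_map f ->
  h_pol f = 0%E -> is_interval (Per f).
Proof.
move=> cf fI h0 p q [/= + [m m0 pm]] [/= + [n n0 qn]] c pcq.
(* The product of a period of [p] and a period of [q] is a period of both. *)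
rewrite !in_itv /= => pI qI; split; first by rewrite /= in_itv /=; lra.
pose k := (m * n)%N; have k0 : (0 < k)%N by rewrite muln_gt0 m0.
have kp : iter k f p = p by rewrite /k mulnC -iter_comp_iter iter_fix.
have kq : iter k f q = q by rewrite /k -iter_comp_iter iter_fix.
exists k => //; apply: contrapT => kc; move: h0.
have pc : p < c.
  by rewrite lt_neqAle; apply/andP; split; [apply/eqP => pc; rewrite -pc in kc|lra].
have cq : c < q.
  by rewrite lt_neqAle; apply/andP; split; [apply/eqP => cq; rewrite cq in kc|lra].
have cg : continuous (iter k f) by exact: iter_continuous.
have [cgc|gcc|cgc] := ltgtP c (iter k f c); last by rewrite -cgc in kc.
  have [u [u0 uI gu u1]] := backward_orbit cg kp pc cgc.
  apply: (backward_orbit_h_pol (u := u) (d := c - u 1%N) k0) => //.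
  - by have := u1 0%N; lra.
  - by move=> n'; have := uI n'; lra.
  - by move=> n'; have [? ?] := u1 n'; rewrite u0 ger0_norm; lra.
(* When [c] moves to the left, reflection makes [1 - q] a fixed point to the left of [1 - c], which
   moves to the right. *)
have [||||u [u0 uI gu u1]] :=
  backward_orbit (g := flip (iter k f)) (p := 1 - q) (c := 1 - c).
- exact: flip_continuous.
- by rewrite /flip subKr kq.
- by lra.
- by rewrite /flip subKr; lra.
apply: (backward_orbit_h_pol (u := fun n => 1 - u n) (d := 1 - c - u 1%N) k0) => //.
- by have := u1 0%N; lra.
- by move=> n'; have := uI n'; lra.
- by move=> n'; rewrite -[in RHS]gu /flip subKr.
- by move=> n'; have [? ?] := u1 n'; rewrite u0 ler0_norm; lra.
Qed.

End BackwardOrbit.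

(** * Maps whose periodic points form an interval *)

Section IntervalPer.
Context {R : realType}.
Implicit Types (f g : R -> R) (e : R).

Lemma Per_image f x : self_map f -> Per f x -> Per f (f x).
Proof.
rewrite /Per /= !in_itv /= => fI [xI [n n0 fx]]; split; first exact: fI.
by exists n => //; rewrite -iterSr iterS fx.
Qed.

(** With a common period [k], applying [f^(k-1)] to [f x = f y] recovers both points. *)
Lemma Per_inj f : {in Per f &, injective f}.
Proof.
move=> x y /set_mem[_ [n n0 fx]] /set_mem[_ [m m0 fy]] fxy.
have k0 : (0 < n * m)%N by rewrite muln_gt0 n0.
have <- : iter (n * m) f x = x by rewrite mulnC -iter_comp_iter iter_fix.
have <- : iter (n * m) f y = y by rewrite -iter_comp_iter iter_fix.
by rewrite -(prednK k0) !iterSr fxy.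
Qed.

(** If [g x < x], monotonicity keeps all later iterates below [x], so the orbit never returns;
    likewise on the other side. *)
Lemma increasing_periodic_fixed (J : set R) g x n :
  (forall y, J y -> J (g y)) ->
  (forall y z, J y -> J z -> y < z -> g y < g z) ->
  J x -> (0 < n)%N -> iter n g x = x -> g x = x.
Proof.
move=> gJ g_lt Jx n0 gnx.
have Jiter m : J (iter m g x) by elim: m => // m /gJ.
case: n n0 gnx => // n _ gnx; have [xgx|gxx|//] := ltgtP (g x) x.
  suff : forall m, iter m.+1 g x < x by move=> /(_ n); rewrite gnx ltxx.
  by elim=> // m IHm; rewrite iterS (lt_trans _ xgx)// g_lt.
suff : forall m, x < iter m.+1 g x by move=> /(_ n); rewrite gnx ltxx.
by elim=> // m IHm; rewrite iterS (lt_trans gxx)// g_lt.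
Qed.

(** A continuous injection of an interval is strictly monotone, so [f^2] is strictly increasing on
    [Per f] in either case, and its periodic points there are fixed. *)
Lemma Per_fixed_iter2 f x : continuous f -> self_map f -> is_interval (Per f) ->
  Per f x -> iter 2 f x = x.
Proof.
move=> cf fI /is_intervalP PerE Px; have [xI [n n0 fx]] := Px.
(* [Rhull] presents the set [Per f] as an [interval], the form that [itv_continuous_inj_mono]
   takes. *)
have PerJ y : Per f y -> y \in Rhull (Per f) by rewrite {1}PerE.
have JPer y : y \in Rhull (Per f) -> y \in Per f by move=> yJ; rewrite inE PerE.
have PerS := Per_image fI.
apply: (increasing_periodic_fixed (J := Per f) (n := n)) => //.
- by move=> y /PerS/PerS.
- have f_inj : {in Rhull (Per f) &, injective f}.
    by move=> y z /JPer Py /JPer Pz; exact: Per_inj.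
  have [f_homo|f_homo] := itv_continuous_inj_mono (continuous_subspaceT cf) f_inj;
    move=> y z Py Pz yz; apply: (f_homo); rewrite ?PerJ//; try exact: PerS;
    by apply: (f_homo); rewrite ?PerJ.
- by rewrite iter_comp_iter mulnC -iter_comp_iter iter_fix.
Qed.

(** * Nearest-point retraction onto a segment *)

Definition clamp (a b x : R) := Num.max a (Num.min x b).

Lemma clamp_itv a b x : a <= b -> a <= clamp a b x <= b.
Proof. by move=> ab; rewrite /clamp le_max lexx ge_max ab ge_min lexx orbT. Qed.

Lemma clamp_id a b x : a <= x <= b -> clamp a b x = x.
Proof. by case/andP=> ax xb; rewrite /clamp min_l// max_r. Qed.

Lemma clamp_left a b x : a <= b -> x <= a -> clamp a b x = a.
Proof. by move=> ab xa; rewrite /clamp min_l ?(le_trans xa)// max_l. Qed.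

Lemma clamp_right a b x : a <= b -> b <= x -> clamp a b x = b.
Proof. by move=> ab bx; rewrite /clamp min_r// max_r. Qed.

Lemma clamp_dist a b x y : a <= b -> `|clamp a b x - clamp a b y| <= `|x - y|.
Proof.
move=> ab; wlog xy : x y / x <= y.
  move=> H; have [/H//|/ltW/H] := leP x y.
  by rewrite distrC [leRHS]distrC.
rewrite [leRHS]ler0_norm ?subr_le0//.
have := clamp_itv x ab; have := clamp_itv y ab.
have [xa|ax] := leP x a; first rewrite (clamp_left ab xa).
  have [ya|ay] := leP y a; first by rewrite (clamp_left ab ya) subrr normr0; lra.
  have [yb|yb] := leP y b.
    by rewrite clamp_id ?ler0_norm; lra.
  by rewrite (clamp_right ab (ltW yb)) ler0_norm; lra.
have [bx|xb] := leP b x.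
  by rewrite (clamp_right ab bx) (clamp_right (x := y) ab) ?subrr ?normr0; lra.
rewrite (clamp_id (x := x)); last lra.
have [yb|yb] := leP y b; first by rewrite clamp_id ?ler0_norm; lra.
by rewrite (clamp_right ab (ltW yb)) ler0_norm; lra.
Qed.

Lemma clamp_continuous a b : a <= b -> continuous (clamp a b).
Proof.
move=> ab x; apply/cvgrPdist_lt => e e0.
apply: filterS (nbhsx_ballx x e e0) => y xy.
exact: le_lt_trans (clamp_dist x y ab) xy.
Qed.

(** * Uniform attraction to a segment of fixed points *)

Definition eventually_ge g (u : R) :=
  exists N, forall n x, (N <= n)%N -> 0 <= x <= 1 -> u <= iter n g x.

(* The infimum of the intersection of the images [iter n g @` `[0, 1]]; by
   symmetry the supremum of that intersection is [1 - low (flip g)]. *)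
Definition low g := sup [set u | eventually_ge g u].

Lemma low_has_sup g : self_map g -> has_sup [set u | eventually_ge g u].
Proof.
move=> gI; split.
  by exists 0, 0%N => n x _ /(iter_self n gI) /andP[].
exists 1 => u [N /(_ N 0 (leqnn N))]; have := iter_self N gI (x := 0).
by rewrite lexx ler01 => /(_ isT) /andP[_ + /(_ isT)] => /[swap]; exact: le_trans.
Qed.

Lemma low_max g u : self_map g -> eventually_ge g u -> u <= low g.
Proof. by move=> gI gu; apply: ub_le_sup => //; have [] := low_has_sup gI. Qed.

Lemma lt_low g u : self_map g -> u < low g -> eventually_ge g u.
Proof.
move=> gI ug; have e0 : 0 < low g - u by lra.
have [v [N vP]] := sup_adherent e0 (low_has_sup gI); rewrite -/(low g) => uv.
by exists N => n x Nn xI; apply: le_trans (vP n x Nn xI); lra.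
Qed.

Lemma low_ge0 g : self_map g -> 0 <= low g.
Proof.
move=> gI; apply: low_max => //; exists 0%N => n x _ /(iter_self n gI).
by case/andP.
Qed.

Lemma low_high_near g d : self_map g -> 0 < d ->
  exists N, forall n x, (N <= n)%N -> 0 <= x <= 1 ->
    low g - d <= iter n g x <= 1 - low (flip g) + d.
Proof.
move=> gI d0.
have [||N NP] := lt_low (g := g) (u := low g - d) => //; first lra.
have [||M MP] := lt_low (g := flip g) (u := low (flip g) - d).
- exact: flip_self.
- lra.
exists (maxn N M) => n x; rewrite geq_max => /andP[Nn Mn] xI.
have := NP n x Nn xI; have := MP n (1 - x) Mn; rewrite iter_flip subKr.
have -> : 0 <= 1 - x <= 1 by lra.
by move=> /(_ isT); lra.
Qed.

Lemma low_le_high g : self_map g -> low g <= 1 - low (flip g).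
Proof.
move=> gI; rewrite leNgt; apply/negP => lt.
pose d := (low g - (1 - low (flip g))) / 3; have d0 : 0 < d by rewrite /d; lra.
have [N /(_ N 0 (leqnn N))] := low_high_near gI d0.
by rewrite lexx ler01 => /(_ isT); rewrite /d; lra.
Qed.

(** Otherwise the minimum [g c] of [g] on the limit segment exceeds [low g]. Late iterates are close
    to that segment, so by uniform continuity the next ones are above the midpoint of [low g] and
    [g c], against the maximality of [low g]. *)
Lemma low_attained g : continuous g -> self_map g ->
  exists2 y, low g <= y <= 1 - low (flip g) & g y <= low g.
Proof.
move=> cg gI; have lowhigh := low_le_high gI.
have low0 := low_ge0 gI; have flip0 := low_ge0 (flip_self gI).
have [|c + cmin] := EVT_min (f := g) lowhigh; first exact: continuous_subspaceT.
rewrite in_itv /= => cI; exists c => //; rewrite leNgt; apply/negP => lt.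
have e0 : 0 < (g c - low g) / 2 by lra.
have [d d0 dP] := uniform_continuity cg e0.
have [N NP] := low_high_near gI d0.
suff : (g c + low g) / 2 <= low g by lra.
apply: low_max => //; exists N.+1 => -[//|n] x Nn xI; rewrite iterS.
have := NP n x Nn xI; move: (iter n g x) => y yP.
pose z := clamp (low g) (1 - low (flip g)) y.
have zP : low g <= z <= 1 - low (flip g) by exact: clamp_itv.
have yz : `|z - y| <= d.
  rewrite /z; have [ylow|lowy] := leP y (low g).
    by rewrite clamp_left// ger0_norm; lra.
  have [highy|yhigh] := leP (1 - low (flip g)) y.
    by rewrite clamp_right// ler0_norm; lra.
  by rewrite clamp_id ?subrr ?normr0; lra.
have gz : g c <= g z by apply: cmin; rewrite in_itv.
have := dP z y; have -> : 0 <= z <= 1 by lra.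
move=> /(_ isT yz); rewrite ler_norml; lra.
Qed.

(* [low g < a] would give a point [y > b] with [g y <= low g] and a point
   [z < a] with [g z >= 1 - low (flip g) >= y], hence some [w] in [[z, a)] with
   [g w = y], so that [g (g w) <= low g <= w]. *)
Lemma low_ge g (a b : R) : continuous g -> self_map g ->
  0 <= a -> a <= b -> b <= 1 -> (forall x, a <= x <= b -> g x = x) ->
  (forall x, 0 <= x < a -> x < g x /\ x < g (g x)) ->
  (forall x, b < x <= 1 -> g x < x) ->
  a <= low g.
Proof.
move=> cg gI a0 ab b1 gid gleft gright; rewrite leNgt; apply/negP => lt.
have low0 := low_ge0 gI; have flip0 := low_ge0 (flip_self gI).
have [y yP gy] := low_attained cg gI.
have [z zP gz] : exists2 z, low g <= z <= 1 - low (flip g) & 1 - low (flip g) <= g z.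
  have [z'] := low_attained (flip_continuous cg) (flip_self gI).
  by rewrite flipK {2}/flip => z'P gz'; exists (1 - z'); lra.
have by_ : b < y.
  rewrite ltNge; apply/negP => yb; have [ya|ay] := ltP y a.
    by have [|? ?] := gleft y; lra.
  by have := gid y; rewrite ay yb => /(_ isT); lra.
have za : z < a.
  rewrite ltNge; apply/negP => az; have [zb|bz] := leP z b.
    by have := gid z; rewrite az zb => /(_ isT); lra.
  by suff : g z < z; [lra|apply: gright; lra].
have ga : g a = a by apply: gid; rewrite lexx ab.
have [||w wP gw] := ivt (f := g) (a := z) (b := a) (v := y) cg.
- exact: ltW.
- by right; rewrite ga; lra.
have wa : w < a.
  rewrite lt_neqAle; apply/andP; split; last lra.
  by apply/eqP => wa; move: gw; rewrite wa ga; lra.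
have [|_] := gleft w; first lra.
by rewrite gw; lra.
Qed.

(** The conditions on [g (g x)] rule out 2-cycles jumping across the segment; imposing them on both
    sides makes the notion invariant under [flip]. *)
Definition attracting_segment g a b := [/\ 0 <= a, a <= b, b <= 1,
  forall x, a <= x <= b -> g x = x &
  (forall x, 0 <= x < a -> x < g x /\ x < g (g x)) /\
  (forall x, b < x <= 1 -> g x < x /\ g (g x) < x)].

Lemma attracting_flip g a b :
  attracting_segment g a b -> attracting_segment (flip g) (1 - b) (1 - a).
Proof.
move=> [a0 ab b1 gid [gleft gright]]; split; [lra|lra|lra| |split].
- by move=> x xab; rewrite /flip gid ?subKr//; lra.
- move=> x xb; rewrite /flip subKr.
  by have [|? ?] := gright (1 - x); lra.
- move=> x xa; rewrite /flip subKr.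
  by have [|? ?] := gleft (1 - x); lra.
Qed.

Lemma attracting_low g a b : continuous g -> self_map g ->
  attracting_segment g a b -> a <= low g.
Proof.
move=> cg gI [a0 ab b1 gid [gleft gright]].
by apply: (low_ge (b := b)) => // x xb; have [] := gright x xb.
Qed.

Lemma uniform_attraction g a b d : continuous g -> self_map g ->
  attracting_segment g a b -> 0 < d ->
  exists N, forall n x, (N <= n)%N -> 0 <= x <= 1 ->
    a - d <= iter n g x <= b + d.
Proof.
move=> cg gI gab d0; have := attracting_low cg gI gab.
have := attracting_low (flip_continuous cg) (flip_self gI) (attracting_flip gab).
move=> b_high a_low; have [N NP] := low_high_near gI d0.
by exists N => n x Nn xI; have := NP n x Nn xI; lra.
Qed.

(** A late orbit that is left of [a] can overshoot [a] only slightly, and then lands on a fixed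
    point of [[a, b]]; so it stays near [a]. The same holds at [b], and inside [[a, b]] nothing
    moves. *)
Lemma orbit_near_clamp g a b e : continuous g -> self_map g ->
  attracting_segment g a b -> 0 < e ->
  exists N, forall x, 0 <= x <= 1 ->
    forall k, `|iter k g (iter N g x) - clamp a b (iter N g x)| <= e.
Proof.
move=> cg gI gab e0; have [a0 ab b1 gid _] := gab.
have [/eqP aEb|a_neq_b] := boolP (a == b).
  have [N NP] := uniform_attraction cg gI gab e0; exists N => x xI k.
  rewrite -iterD; have := NP (k + N)%N x (leq_addl _ _) xI.
  by have := clamp_itv (iter N g x) ab; rewrite ler_norml; lra.
have ltab : a < b by rewrite lt_neqAle a_neq_b.
(* The bound [b - a] makes all of [[a, a + m]] and [[b - m, b]] fixed points. *)
pose m := Num.min e (b - a).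
have m0 : 0 < m by rewrite lt_min e0; lra.
have me : m <= e by rewrite ge_min lexx.
have mba : m <= b - a by rewrite ge_min lexx orbT.
have [d d0 dP] := uniform_continuity cg m0.
(* Closeness [d] controls the next step by uniform continuity; closeness [e] bounds the excursion on
   the outer side. *)
have d'0 : 0 < Num.min d e by rewrite lt_min d0.
have [N NP] := uniform_attraction cg gI gab d'0; exists N => x xI k.
have {}NP j : [/\ a - d <= iter (j + N) g x <= b + d &
    a - e <= iter (j + N) g x <= b + e].
  have := NP (j + N)%N x (leq_addl _ _) xI.
  have : Num.min d e <= d by rewrite ge_min lexx.
  have : Num.min d e <= e by rewrite ge_min lexx orbT.
  by move=> ? ? ?; split; lra.
have ga : g a = a by apply: gid; lra.
have gb : g b = b by apply: gid; lra.
have step_a w : a - d <= w -> w <= a + m -> g w <= a + m.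
  move=> dw wm; have [wa|aw] := leP w a; last by rewrite gid; lra.
  have : `|g a - g w| <= m by apply: dP; [lra|rewrite ger0_norm; lra].
  by rewrite ga ler_norml; lra.
have step_b w : w <= b + d -> b - m <= w -> b - m <= g w.
  move=> dw wm; have [wb|bw] := ltP w b; first by rewrite gid; lra.
  have : `|g b - g w| <= m by apply: dP; [lra|rewrite ler0_norm; lra].
  by rewrite gb ler_norml; lra.
rewrite -iterD; have [ua|au] := ltP (iter N g x) a.
  rewrite clamp_left//; last exact: ltW.
  suff : iter (k + N) g x <= a + m by have [_] := NP k; rewrite ler_norml; lra.
  elim: k => [|k IHk]; first by rewrite add0n; lra.
  by rewrite addSn iterS step_a//; have [] := NP k; lra.
have [ub|bu] := leP (iter N g x) b.
  by rewrite clamp_id ?au// iterD iter_fix ?gid ?au// subrr normr0 ltW.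
rewrite clamp_right//; last exact: ltW.
suff : b - m <= iter (k + N) g x by have [_] := NP k; rewrite ler_norml; lra.
elim: k => [|k IHk]; first by rewrite add0n; lra.
by rewrite addSn iterS step_b//; have [] := NP k; lra.
Qed.

(** Uniform continuity handles the first [N] steps; afterwards each orbit is within [e / 3] of its
    clamped [N]-th point, and [clamp] is 1-Lipschitz. *)
Lemma attracting_equicontinuous g a b : continuous g -> self_map g ->
  attracting_segment g a b -> equicontinuous_iterates g.
Proof.
move=> cg gI gab e e0; have e30 : 0 < e / 3 by lra.
have [N NP] := orbit_near_clamp cg gI gab e30; have [_ ab _ _ _] := gab.
have [d d0 dP] := uniform_continuity_iter N cg gI e30.
exists d => // x y xI yI xy n.
have [nN|/ltnW/subnK <-] := leqP n N.
  by apply: le_trans (dP x y xI yI xy n nN) _; lra.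
have := NP x xI (n - N)%N; have := NP y yI (n - N)%N.
have := dP x y xI yI xy N (leqnn N); rewrite !iterD.
move: (iter N g x) (iter N g y) => u v uv.
have := clamp_dist u v ab; rewrite !ler_norml; lra.
Qed.

(** * Fixed points, and the consequences of [Per f] being an interval *)

Lemma exists_fixed_left g x : continuous g -> self_map g -> 0 <= x <= 1 ->
  g x <= x -> exists2 c, 0 <= c <= x & g c = c.
Proof.
move=> cg gI xI gx; pose h t := g t - t.
have ch : continuous h by move=> t; apply: cvgB; [exact: cg|exact: cvg_id].
have [||c cx hc] := ivt (f := h) (a := 0) (b := x) (v := 0) ch; first lra.
  by right; rewrite /h subr0; have := gI 0; rewrite lexx ler01 => /(_ isT); lra.
by exists c => //; apply/eqP; rewrite -subr_eq0 -/(h c) hc.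
Qed.

Lemma exists_fixed_right g x : continuous g -> self_map g -> 0 <= x <= 1 ->
  x <= g x -> exists2 c, x <= c <= 1 & g c = c.
Proof.
move=> cg gI xI gx.
have [||||c cx] := exists_fixed_left (g := flip g) (x := 1 - x).
- exact: flip_continuous.
- exact: flip_self.
- lra.
- by rewrite /flip subKr; lra.
by rewrite /flip => gc; exists (1 - c); lra.
Qed.

(** Here [Per f] is the set of fixed points of [f^2] in [0, 1], hence compact, and it contains a
    fixed point of [f]; its minimum and maximum are the endpoints. *)
Lemma interval_Per_endpoints f : continuous f -> self_map f ->
  is_interval (Per f) ->
  exists a b, [/\ 0 <= a, a <= b, b <= 1 &
    forall x, Per f x <-> a <= x <= b].
Proof.
move=> cf fI itvPer.
have fix2P x : Per f x <-> 0 <= x <= 1 /\ iter 2 f x = x.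
  split=> [Px|[xI fx]]; last by split; [rewrite /= in_itv|exists 2%N].
  by split; [have [] := Px; rewrite /= in_itv|exact: Per_fixed_iter2].
have Per0 : Per f !=set0.
  have [||c cI fc] := exists_fixed_left (x := 1) cf fI; first by rewrite ler01 lexx.
    by have := fI 1; rewrite lexx ler01 => /(_ isT)/andP[].
  by exists c; split; [rewrite /= in_itv|exists 1%N].
have closedPer : closed (Per f).
  pose h x := iter 2 f x - x.
  have -> : Per f = `[0, 1]%classic `&` h @^-1` [set y | y = 0].
    apply/seteqP; split=> x /=.
      by move=> /fix2P [xI fx]; rewrite in_itv; split=> //; rewrite /h fx subrr.
    rewrite in_itv => -[xI /eqP]; rewrite subr_eq0 => /eqP fx.
    exact/fix2P.
  apply: closedI; first exact: interval_closed.
  apply: preimage_closed; last exact: closed_eq.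
  move=> x _; apply: cvgB; last exact: cvg_id.
  exact: iter_continuous.
have cPer : compact (Per f).
  apply: (subclosed_compact closedPer (@segment_compact R 0 1)).
  by move=> x [].
have cid : {within Per f, continuous (@id R)}.
  by apply: continuous_subspaceT => x; exact: cvg_id.
have [a /set_mem Pa amin] := compact_EVT_min Per0 cPer cid.
have [b /set_mem Pb bmax] := compact_EVT_max Per0 cPer cid.
have /fix2P[aI _] := Pa; have /fix2P[bI _] := Pb.
exists a, b; split; [lra|exact: bmax (mem_set Pa)|lra|].
move=> x; split=> [Px|]; last exact: itvPer Pa Pb x.
by rewrite (amin x (mem_set Px)) (bmax x (mem_set Px)).
Qed.

Lemma interval_Per_h_pol f : continuous f -> self_map f ->
  is_interval (Per f) -> h_pol f = 0%E.
Proof.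
move=> cf fI itvPer.
have [a [b [a0 ab b1 PerE]]] := interval_Per_endpoints cf fI itvPer.
have fixPer n x : (0 < n)%N -> 0 <= x <= 1 -> iter n f x = x -> a <= x <= b.
  by move=> n0 xI fx; apply/PerE; split; [rewrite /= in_itv|exists n].
(* Were [f^n x <= x], then [f^n] would have a fixed point in [[0, x]], a periodic point of [f] below
   [a]. *)
have right_of n x : (0 < n)%N -> 0 <= x < a -> x < iter n f x.
  move=> n0 xa; rewrite ltNge; apply/negP => fx.
  have [|||c cx fc] := exists_fixed_left _ _ _ fx; last 1 first.
  - have cI : 0 <= c <= 1 by lra.
    by have := fixPer n c n0 cI fc; lra.
  - exact: iter_continuous.
  - exact: iter_self.
  - lra.
have left_of n x : (0 < n)%N -> b < x <= 1 -> iter n f x < x.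
  move=> n0 xa; rewrite ltNge; apply/negP => fx.
  have [|||c cx fc] := exists_fixed_right _ _ _ fx; last 1 first.
  - have cI : 0 <= c <= 1 by lra.
    by have := fixPer n c n0 cI fc; lra.
  - exact: iter_continuous.
  - exact: iter_self.
  - lra.
apply: equicontinuous_h_pol; apply: equicontinuous_iter2 => //.
apply: (attracting_equicontinuous (a := a) (b := b)).
- exact: iter_continuous.
- exact: iter_self.
split=> //; last split.
- by move=> x /PerE; exact: Per_fixed_iter2.
(* For [g = f^2], the condition on [g (g x)] concerns [f^4]. *)
- by move=> x xa; split; [exact: (right_of 2%N)|exact: (right_of 4%N)].
- by move=> x xb; split; [exact: (left_of 2%N)|exact: (left_of 4%N)].
Qed.

Lemma interval_Per_type f : continuous f -> self_map f ->
  is_interval (Per f) ->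
  sharkovskii_type f (Period 1) \/ sharkovskii_type f (Period 2).
Proof.
move=> cf fI itvPer.
have period1 : periods f 1%N.
  have [||c cI fc] := exists_fixed_left (x := 1) cf fI; first by rewrite ler01 lexx.
    by have := fI 1; rewrite lexx ler01 => /(_ isT)/andP[].
  by exists c; [rewrite /= in_itv|split=> // m; case: m => [|[]]].
have period12 n : periods f n -> n = 1%N \/ n = 2%N.
  move=> [x xI [n0 fx least]].
  have f2x : iter 2 f x = x.
    by apply: Per_fixed_iter2 => //; split=> //; exists n.
  case: n n0 fx least => [|[|[|n]]] // _ _ least; [by left|by right|].
  by case: (least 2%N isT).
have [period2|nperiod2] := pselect (periods f 2%N).
  right; split=> // m /period12[->|->]; last by left.
  by right; rewrite /= /odd_part partn1 eqxx logn1 orbT.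
left; split=> // m Pm; have [->|mE] := period12 m Pm; first by left.
by case: nperiod2; rewrite -mE.
Qed.

End IntervalPer.

(** * Independence from the values outside [0, 1] *)

Section Extension.
Context {R : realType}.
Variables (f F : R -> R).
Hypothesis F_self : self_map F.
Hypothesis fE : forall x, 0 <= x <= 1 -> f x = F x.

Let iterE n x : 0 <= x <= 1 -> iter n f x = iter n F x.
Proof. by move=> xI; elim: n => //= n ->; rewrite fE//; exact: iter_self. Qed.

Lemma Per_eq : Per f = Per F.
Proof.
apply/seteqP; split=> x [xI [n n0 fx]]; split=> //; exists n => //.
  by rewrite -iterE//; move: xI; rewrite /= in_itv.
by rewrite iterE//; move: xI; rewrite /= in_itv.
Qed.

Lemma h_pol_eq : h_pol f = h_pol F.
Proof.
have distE n x y : 0 <= x <= 1 -> 0 <= y <= 1 ->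
    dynamic_dist n f x y = dynamic_dist n F x y.
  by move=> xI yI; apply: eq_bigr => i _; rewrite !iterE.
have sepE n e : Defs.separated n e f = Defs.separated n e F.
  apply/funext => S; apply/propext; split=> -[SI Ssep]; split=> // x y Sx Sy xy.
    rewrite -distE; first exact: Ssep.
      by have := SI x Sx; rewrite /= in_itv.
    by have := SI y Sy; rewrite /= in_itv.
  rewrite distE; first exact: Ssep.
    by have := SI x Sx; rewrite /= in_itv.
  by have := SI y Sy; rewrite /= in_itv.
by rewrite /h_pol /sep; under eq_fun do under eq_fun do rewrite sepE.
Qed.

Lemma periods_eq : periods f = periods F.
Proof.
apply/seteqP; split=> n [x xI [n0 fx least]]; have : 0 <= x <= 1 by
  [move: xI; rewrite /= in_itv] => xI'; exists x => //; split=> //.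
- by rewrite -iterE.
- by move=> m /least; rewrite iterE.
- by rewrite iterE.
- by move=> m /least; rewrite -iterE.
Qed.

Lemma sharkovskii_type_eq t : sharkovskii_type f t = sharkovskii_type F t.
Proof. by case: t => [n|]; rewrite /= periods_eq. Qed.

End Extension.

Theorem theorem29 (R : realType) (f : R -> R)
    (f_self : set_fun `[0, 1] `[0, 1] f)
    (f_cont : {within `[0, 1], continuous f}) :
  (h_pol f = 0%E <-> connected (Per f)) /\
  (h_pol f = 0%E ->
     sharkovskii_type f (Period 1) \/ sharkovskii_type f (Period 2)).
Proof.
(* Extending [f] by constants beyond 0 and 1 gives a map continuous on the whole line. *)
pose F := f \o clamp 0 1.
have clampI (x : R) : `[0, 1]%classic (clamp 0 1 x).
  by rewrite /= in_itv /=; exact: clamp_itv.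
have fE x : 0 <= x <= 1 -> f x = F x by move=> xI; rewrite /F /= clamp_id.
have F_self : self_map F.
  by move=> x _; have := f_self _ (clampI x); rewrite /= in_itv.
have F_cont : continuous F.
  move=> x; have /subspace_continuousP/(_ _ (clampI x)) := f_cont.
  apply: cvg_comp => A /(@clamp_continuous R 0 1 ler01 x).
  by apply: (@filterS _ (nbhs x)) => y; apply; exact: clampI.
rewrite (h_pol_eq F_self fE) (Per_eq F_self fE) !(sharkovskii_type_eq F_self fE).
split; first split=> [h0|/connected_intervalP itvPer].
- by apply/connected_intervalP; exact: Per_is_interval.
- exact: interval_Per_h_pol.
- by move=> h0; apply: interval_Per_type => //; exact: Per_is_interval.
Qed.
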